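(* (i) The group $G(A)$ is an index $2$ subgroup of $G(B^{(\{0,1\})})$; (ii) for any $n\ge1$ the group $G(A^{(n)})$ is an index $2$ subgroup of $G(B^{(\{0,n\})})$; (iii) for any nonempty finite set $N$ of positive integers the group $G(A^{(N)})$ is an index $2$ subgroup of $G(B^{(N\cup\{0\})})$.
   Context: An automaton is a quadruple $(Q,X,\phi,\psi)$ with nonempty sets $Q$ (internal states) and $X$ (finite alphabet), a state transition function $\phi:Q\times X\to Q$ and an output function $\psi:Q\times X\to X$. Let $X^*$ be the set of finite words over $X$ (including the empty word). For an automaton $Y=(Q,X,\phi,\psi)$ and $q\in Q$, the transformation $Y_q:X^*\to X^*$ is defined recursively by $Y_q(\varnothing)=\varnothing$ and $Y_q(xw)=\psi(q,x)\,Y_{\phi(q,x)}(w)$ for $x\in X$, $w\in X^*$. $Y$ is invertible if all $Y_q$, $q\in Q$, are bijective; then $G(Y)$ is the group of transformations of $X^*$ generated (under composition) by $Y_q$, $q\in Q$. For $n\ge1$ let $Q_1=\{a_1,b_1,c_1\}$ and $Q_n=\{a_n,b_n,c_n,q_{n1},\dots,q_{n,2n-2}\}$ for $n\ge2$ ($2n+1$ elements), and let $Q_0=\{c_0\}$; the sets $Q_n$, $n\ge0$, are pairwise disjoint. For $n\ge1$, with $q_{n0}:=c_n$ and $q_{n,2n-1}:=a_n$, define $\phi_n:Q_n\times\{0,1\}\to Q_n$ by $\phi_n(a_n,0)=\phi_n(b_n,1)=c_n$, $\phi_n(a_n,1)=\phi_n(b_n,0)=b_n$, and $\phi_n(q_{ni},0)=\phi_n(q_{ni},1)=q_{n,i+1}$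 for $0\le i\le 2n-2$. The Aleshin type automaton is $A^{(n)}=(Q_n,\{0,1\},\phi_n,\psi_n)$, where $\psi_n(q,x)=1-x$ if $q\in\{a_n,b_n\}$ and $\psi_n(q,x)=x$ otherwise. The Bellaterra type automaton is $B^{(n)}=(Q_n,\{0,1\},\phi_n,\widehat\psi_n)$, where $\widehat\psi_n(q,x)=1-\psi_n(q,x)$. $B^{(0)}$ is the one-state automaton over $\{0,1\}$ with state $c_0$, transitions $c_0\mapsto c_0$ for both letters, and output function interchanging $0$ and $1$. The Aleshin automaton $A$ is $A^{(1)}$ with states $a_1,b_1,c_1$ renamed $a,b,c$. All these automata are invertible. The disjoint union of finitely many automata over the same alphabet with pairwise disjoint state sets is the automaton whose state set is the union of the state sets and whose transition and output functions restrict to those of each component. $A^{(N)}$ (for $N$ a nonempty finite set of positive integers) and $B^{(N)}$ (for $N$ a nonempty finite set of nonnegative integers) are the disjoint unions of $A^{(n)}$, $n\in N$, and of $B^{(n)}$, $n\in N$, respectively. *)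

(* Defs.v *)
From mathcomp Require Import all_boot finmap.
From mathcomp Require Import boolp classical_sets functions cardinality.

Set Implicit Arguments.
Unset Strict Implicit.
Unset Printing Implicit Defensive.

Local Open Scope classical_set_scope.

(* Nonemptiness of the alphabet and of the state set is not part of the
   record: the alphabet used below is [bool], the sets Q_n are nonempty, and
   disjoint unions are only considered over nonempty sets of indices. *)
Record automaton (X : finType) := Automaton {
  state : Type;
  trans : state -> X -> state;
  out : state -> X -> X
}.

Fixpoint action (X : finType) (Y : automaton X) (q : state Y) (w : seq X) :
    seq X :=
  if w is x :: w' then out q x :: action (trans q x) w' else [::].

Definition invertible (X : finType) (Y : automaton X) : Prop :=
  forall q : state Y, bijective (action q).

Definition transformation_group (T : Type) (G : set (T -> T)) : Prop :=
  [/\ forall f, G f -> bijective f,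
      G id,
      forall f g, G f -> G g -> G (f \o g) &
      forall f g, G f -> cancel f g -> cancel g f -> G g].

(* For an invertible automaton the family of groups being intersected is not
   empty, since it contains the group of all bijections. *)
Definition automaton_group (X : finType) (Y : automaton X) :
    set (seq X -> seq X) :=
  smallest (@transformation_group (seq X)) (range (@action X Y)).

Definition subgroup_of_index (T : Type) (k : nat) (H G : set (T -> T)) : Prop :=
  [/\ transformation_group H, transformation_group G, H `<=` G &
      ([set [set g \o h | h in H] | g in G] #= `I_k)%card].

Definition disjoint_union (X : finType) (I : Type) (Y : I -> automaton X) :
    automaton X :=
  @Automaton X {i : I & state (Y i)}
    (fun q x => existT _ (projT1 q) (trans (projT2 q) x))
    (fun q x => out (projT2 q) x).

(* Q_n for n >= 1; the ordinal k stands for the index k + 1, that is,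
   [Q_q k] is q_{n,k+1}.  The value at n = 0 is never used. *)
Inductive Q (n : nat) : Type :=
  | Q_a | Q_b | Q_c | Q_q of 'I_(2 * n - 2).

Arguments Q_a {n}.
Arguments Q_b {n}.
Arguments Q_c {n}.

(* q_{ni} for 0 <= i <= 2n - 1, with q_{n0} = c_n and q_{n,2n-1} = a_n. *)
Definition chain (n i : nat) : Q n :=
  if i is k.+1 then
    if insub k is Some j then Q_q j else Q_a
  else Q_c.

(* The letters 0 and 1 are [false] and [true], and 1 - x is [~~ x]. *)
Definition phi (n : nat) (q : Q n) (x : bool) : Q n :=
  match q with
  | Q_a => if x then Q_b else Q_c
  | Q_b => if x then Q_c else Q_b
  | Q_c => chain n 1
  | Q_q j => chain n j.+2
  end.

Definition psi (n : nat) (q : Q n) (x : bool) : bool :=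
  match q with
  | Q_a | Q_b => ~~ x
  | _ => x
  end.

Definition aleshin_type (n : nat) : automaton bool :=
  Automaton (@phi n) (@psi n).

Definition bellaterra_type (n : nat) : automaton bool :=
  if n is 0 then
    @Automaton bool unit (fun c0 _ => c0) (fun _ x => ~~ x)
  else
    Automaton (@phi n) (fun q x => ~~ psi q x).

Definition aleshin : automaton bool := aleshin_type 1.

Definition aleshin_union (N : {fset nat}) : automaton bool :=
  disjoint_union (fun n : N => aleshin_type (val n)).

Definition bellaterra_union (N : {fset nat}) : automaton bool :=
  disjoint_union (fun n : N => bellaterra_type (val n)).

Lemma involutive_out_invertible (X : finType) (Y : automaton X) :
  (forall q : state Y, involutive (@out X Y q)) -> invertible Y.
Proof.
move=> outK q.
pose Z := Automaton (fun (q : state Y) x => trans q (out q x)) (@out X Y).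
exists (@action X Z q) => w; elim: w q => //= x w IH q.
  by rewrite outK IH.
by rewrite outK IH.
Qed.

Lemma aleshin_type_invertible (n : nat) : invertible (aleshin_type n).
Proof. by apply: involutive_out_invertible => -[|||j] []. Qed.

Lemma aleshin_union_invertible (N : {fset nat}) : invertible (aleshin_union N).
Proof. by apply: involutive_out_invertible => -[n [|||j]] []. Qed.

Lemma bellaterra_union_invertible (N : {fset nat}) :
  invertible (bellaterra_union N).
Proof.
by apply: involutive_out_invertible => -[[[|n] nN]] /= => [[]|[|||j]] [].
Qed.

(* Main.v *)
(* Let s be the transformation inverting all letters. The states of B^(n)
   act as s f, where f is the action of the same state of A^(n), and they are
   involutions; hence s f s = f^-1, the element s normalizes the group H
   generated by the Aleshin actions, and the Bellaterra group is the union of H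
   and s H. To see that s is not in H, compare for a tree automorphism the
   parities of the numbers of flips at the root and at the two vertices of the
   first level: both are homomorphisms, they agree on the generators of H, but
   they differ on s. *)
Require Import Defs.
From mathcomp Require Import all_boot finmap.
From mathcomp Require Import boolp classical_sets cardinality.

Set Implicit Arguments.
Unset Strict Implicit.
Unset Printing Implicit Defensive.

Local Open Scope classical_set_scope.

Section GeneratedGroup.
Variable T : Type.
Implicit Types (S G : set (T -> T)) (f g h s : T -> T).

(** For [S] the range of the actions of [Y] this is convertible with [automaton_group Y], so the
    results below apply to it directly. *)
Definition generated S := smallest (@transformation_group T) S.

Lemma sub_generated S : S `<=` generated S.
Proof. by move=> f Sf G [_]; apply. Qed.

Lemma generated_sub S G :
  transformation_group G -> S `<=` G -> generated S `<=` G.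
Proof. by move=> tG SG f; apply; split. Qed.

Lemma bijections_group : transformation_group [set f : T -> T | bijective f].
Proof.
split=> //=; first by exists id.
- by move=> f g; apply: bij_comp.
- by move=> f g _ fK gK; exists f.
Qed.

Lemma generated_group S :
  (forall f, S f -> bijective f) -> transformation_group (generated S).
Proof.
move=> Sbij; split.
- exact: (generated_sub bijections_group).
- by move=> G [[]].
- by move=> f g Sf Sg G GS; case: (GS) => -[_ _ mulG _] _;
    apply: mulG; [apply: Sf | apply: Sg].
- by move=> f g Sf fK gK G GS; case: (GS) => -[_ _ _ invG] _;
    apply: (invG f) => //; apply: Sf.
Qed.

Lemma conj_generated S s h :
  (forall f, S f -> bijective f) -> involutive s ->
  (forall f, S f -> involutive (s \o f)) ->
  generated S h -> generated S (s \o h \o s).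
Proof.
move=> Sbij sK sfK Sh.
have [Hbij H1 HM HV] := generated_group Sbij.
suff /(_ h Sh) [] : generated S `<=`
  [set f | bijective f /\ generated S (s \o f \o s)] by [].
apply: generated_sub => [|f Sf] /=; last first.
  split; first exact: Sbij.
  apply: (HV f); first exact: sub_generated.
    exact: sfK.
  move=> x /=; apply: (can_inj sK).
  by have /= -> := sfK f Sf (s x).
split=> /=.
- by move=> f [].
- by split; [exists id | rewrite (_ : _ \o s = id) //; apply: funext].
- move=> f g [fb Hf] [gb Hg]; split; first exact: bij_comp.
  rewrite (_ : _ \o s = (s \o f \o s) \o (s \o g \o s)); first exact: HM.
  by apply: funext => x /=; rewrite sK.
- move=> f g [fb Hf] fK gK; split; first by exists f.
  by apply: (HV _ _ Hf) => x /=; rewrite sK ?fK ?gK sK.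
Qed.

Lemma generated_index2 S s :
  (forall f, S f -> bijective f) -> involutive s ->
  (forall f, S f -> involutive (s \o f)) -> ~ generated S s ->
  subgroup_of_index 2 (generated S)
    (generated (s |` [set s \o f | f in S])).
Proof.
move=> Sbij sK sfK Ns; set H := generated S; set S' := _ |` _.
set G := generated S'.
have tH : transformation_group H by apply: generated_group.
have tG : transformation_group G.
  apply: generated_group => f [->|[g Sg <-]]; first by exists s.
  by apply: bij_comp; [exists s | apply: Sbij].
have [Hbij H1 HM HV] := tH; have [_ G1 GM _] := tG.
have ssE f : s \o (s \o f) = f by apply: funext => x /=; rewrite sK.
have Gs : G s by apply: sub_generated; left.
have HG : H `<=` G.
  apply: generated_sub => // f Sf; rewrite -[f]ssE; apply: GM => //.
  by apply: sub_generated; right; exists f.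
have conjH h : H h -> H (s \o h \o s) by apply: conj_generated.
(* The union of [H] and [s H] is a group: with [s^2 = 1], [conjH] moves [s] past elements of [H] in
   products and inverses. *)
have GE f : G f -> H f \/ H (s \o f).
  suff tK : transformation_group [set f | bijective f /\ (H f \/ H (s \o f))].
    suff GK : G `<=` [set f | bijective f /\ (H f \/ H (s \o f))].
      by case/GK.
    apply: generated_sub => // g [->|[h Sh <-]] /=.
      split; first by exists s.
      by right; rewrite (_ : s \o s = id) //; apply: funext.
    split; first by apply: bij_comp; [exists s | apply: Sbij].
    by right; rewrite ssE; apply: sub_generated.
  split=> /=.
  - by move=> g [].
  - by split; [exists id | left].
  - move=> g h [gb Hg] [hb Hh]; split; first exact: bij_comp.
    case: Hg Hh => Hg [] Hh.
    + by left; apply: HM.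
    + right; rewrite (_ : _ \o _ = (s \o g \o s) \o (s \o h)).
        by apply: HM => //; apply: conjH.
      by apply: funext => x /=; rewrite sK.
    + by right; apply: (HM (s \o g)).
    + left; rewrite (_ : _ \o _ = (s \o (s \o g) \o s) \o (s \o h)).
        by apply: HM => //; apply: conjH.
      by apply: funext => x /=; rewrite !sK.
  - move=> g h [gb Hg] gK hK; split; first by exists g.
    case: Hg => Hg; first by left; apply: (HV g).
    (* Here [h] inverts [g], so [h s] is the inverse of [s g], an element of [H]. *)
    right; rewrite (_ : s \o h = s \o (h \o s) \o s); last first.
      by apply: funext => x /=; rewrite sK.
    apply: conjH; apply: (HV _ _ Hg) => x /=; first by rewrite sK gK.
    by rewrite hK sK.
split=> //.
have cosetE g : H g -> [set g \o h | h in H] = H.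
  move=> Hg; apply/seteqP; split=> f /=; first by case=> h Hh <-; apply: HM.
  move=> Hf; case: (Hbij _ Hg) => g' gK g'K.
  exists (g' \o f); first by apply: HM => //; apply: (HV g).
  by apply: funext => x /=; rewrite g'K.
have coset_sE g : H (s \o g) -> [set g \o h | h in H] = [set s \o h | h in H].
  move=> Hg; rewrite -{2}(cosetE _ Hg) image_comp; congr image.
  by apply: funext => h /=; rewrite -{1}[g]ssE.
have -> : [set [set g \o h | h in H] | g in G]
    = [set H; [set s \o h | h in H]].
  apply/seteqP; split=> [_ [g Gg <-]|_ [->|->]] /=.
  - by case: (GE _ Gg) => Hg; [left; apply: cosetE | right; apply: coset_sE].
  - by exists id => //; apply: cosetE.
  - by exists s.
have neqH : H <> [set s \o h | h in H].
  move=> e; apply: Ns; change (H s); rewrite e; by exists id.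
apply/eq_cardSP; exists H; first by left.
rewrite (_ : _ `\ H = [set [set s \o h | h in H]]).
  exact: card_set1.
apply/seteqP; split=> [A [[//|]]|_ ->] //.
by split; [right | move=> e; apply: neqH].
Qed.

End GeneratedGroup.

Implicit Types (f g h : seq bool -> seq bool) (N M : {fset nat}).

(* [p] is the flip at the root and [e x] the flip at the vertex [x]. *)
Definition flip_parities_agree f : Prop :=
  exists (p : bool) (e : bool -> bool),
    (forall x y, f [:: x; y] = [:: x (+) p; y (+) e x]) /\
    p = e false (+) e true.

Lemma flip_parities_agree_group :
  transformation_group [set f | bijective f /\ flip_parities_agree f].
Proof.
split=> /=.
- by move=> f [].
- split; first by exists id.
  by exists false, xpred0; split=> // x y; rewrite !addbF.
- move=> f g [fb [p [e [fE pE]]]] [gb [q [d [gE qE]]]].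
  split; first exact: bij_comp.
  (* After [g], the vertex [x] sits at [x (+) q], where [f] acts. Since [x] and [x (+) q] run over
     the same two vertices, the parities add up. *)
  exists (q (+) p), (fun x => d x (+) e (x (+) q)); split.
    by move=> x y; rewrite /= gE fE !addbA.
  by rewrite qE pE; case: (d _); case: (d _); case: (e false); case: (e true).
- move=> f g [fb [p [e [fE pE]]]] fK gK; split; first by exists f.
  (* The inverse undoes at [x] the flip that [f] makes at the preimage [x (+) p]. *)
  exists p, (fun x => e (x (+) p)); split.
    by move=> x y; apply: (can_inj fK); rewrite gK fE !addbK.
  by rewrite {1}pE; case: (p); rewrite /= 1?addbC.
Qed.

(** The states [Q_a] and [Q_b] flip, and exactly one of their two successors, [Q_b], flips. Every
    other state is passive, and its two successors coincide. *)
Lemma aleshin_type_flip_parities n (q : Q n) :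
  flip_parities_agree (@action _ (aleshin_type n) q).
Proof.
exists (psi q false), (fun x => psi (phi q x) false); split; last first.
  by case: q => [||| j] //=; rewrite addbb.
move=> x y; have psiE (r : Q n) z : psi r z = z (+) psi r false.
  by case: r => *; rewrite /= ?addbT ?addbF.
by rewrite /= psiE (psiE _ y).
Qed.

(** One flip at the root is odd, two flips on the first level are even. *)
Lemma complement_flip_parities : ~ flip_parities_agree (map negb).
Proof.
case=> p [e [fE pE]]; move: pE (fE false false) (fE true false) => /= ->.
by case: (e false); case: (e true).
Qed.

Lemma complement_involutive : involutive (map negb).
Proof. exact: mapK negbK. Qed.

Lemma bellaterra_actionE n (q : Q n) :
  @action _ (Automaton (@phi n) (fun q x => ~~ psi q x)) q
  = map negb \o @action _ (aleshin_type n) q.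
Proof. by apply: funext => w; elim: w q => //= x w IH q; rewrite IH. Qed.

(** The Bellaterra states [Q_a] and [Q_b] keep the letter. The others invert it, but their
    transitions ignore the letter. So a second pass visits the same states. *)
Lemma bellaterra_action_involutive n (q : Q n) :
  involutive (map negb \o @action _ (aleshin_type n) q).
Proof.
rewrite -bellaterra_actionE => w; elim: w q => //= x w IH q.
by rewrite -[X in _ = _ :: X](IH (phi q x)); case: q x => [||| j] [].
Qed.

Lemma disjoint_union_action (X : finType) I (Y : I -> automaton X) i
  (q : state (Y i)) :
  @action X (disjoint_union Y) (existT _ i q) = @action X (Y i) q.
Proof. by apply: funext => w; elim: w q => //= x w IH q; rewrite IH. Qed.

(** Excluding the index 0 makes this set the same for [N] and for [N] with 0 added. *)
Definition aleshin_actions N : set (seq bool -> seq bool) :=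
  [set f | exists n, [/\ n \in N, 0 < n &
     exists q, f = @action _ (aleshin_type n) q]].

Lemma range_aleshin_union N : (forall n, n \in N -> 0 < n) ->
  range (@action _ (aleshin_union N)) = aleshin_actions N.
Proof.
move=> N0; apply/seteqP; split=> [_ [[n q] _ <-]|_ [n [nN _ [q ->]]]].
  exists (val n); rewrite N0 ?(valP n) //; split=> //; exists q.
  exact: disjoint_union_action.
exists (existT _ [`nN]%fset q) => //; exact: disjoint_union_action.
Qed.

Lemma range_bellaterra_union M : 0 \in M ->
  range (@action _ (bellaterra_union M))
  = map negb |` [set map negb \o f | f in aleshin_actions M].
Proof.
move=> M0; apply/seteqP; split=> [_ [[[n nM] q] _ <-]|f].
  rewrite disjoint_union_action; case: n nM q => [|n] nM /= q.
    (* The single state of [bellaterra_type 0] acts as the complement itself. *)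
    by left; apply: funext => w; elim: w q => //= x w IH q; rewrite IH.
  right; rewrite bellaterra_actionE.
  exists (@action _ (aleshin_type n.+1) q) => //.
  by exists n.+1; split=> //; exists q.
case=> [->|[_ [[|n] [nM // _ [q ->]]] <-]].
  exists (existT _ [`M0]%fset tt) => //; rewrite disjoint_union_action.
  by apply: funext => w; elim: w => //= x w ->.
exists (existT _ [`nM]%fset q) => //; rewrite disjoint_union_action.
exact: bellaterra_actionE.
Qed.

Lemma aleshin_actions_index2 M S :
  0 \in M -> aleshin_actions M = S ->
  subgroup_of_index 2 (generated S) (automaton_group (bellaterra_union M)).
Proof.
move=> M0 <-; rewrite /automaton_group range_bellaterra_union //.
have Sbij f : aleshin_actions M f -> bijective f.
  by move=> [n [_ _ [q ->]]]; apply: aleshin_type_invertible.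
apply: generated_index2 => //.
- exact: complement_involutive.
- by move=> f [n [_ _ [q ->]]]; apply: bellaterra_action_involutive.
- suff /[apply] : generated (aleshin_actions M)
      `<=` [set f | bijective f /\ flip_parities_agree f].
    by case=> _ /complement_flip_parities.
  apply: generated_sub; first exact: flip_parities_agree_group.
  move=> f Sf; split; first exact: Sbij.
  by case: Sf => [n [_ _ [q ->]]]; apply: aleshin_type_flip_parities.
Qed.

Theorem proposition1p11 :
  (subgroup_of_index 2 (automaton_group aleshin)
     (automaton_group (bellaterra_union [fset 0; 1]%fset)))
  /\
  (forall n : nat, 1 <= n ->
     subgroup_of_index 2 (automaton_group (aleshin_type n))
       (automaton_group (bellaterra_union [fset 0; n]%fset)))
  /\
  (forall N : {fset nat}, N <> fset0 -> (forall n, n \in N -> 1 <= n) ->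
     subgroup_of_index 2 (automaton_group (aleshin_union N))
       (automaton_group (bellaterra_union (N `|` [fset 0])%fset))).
Proof.
have index2 n : 1 <= n ->
    subgroup_of_index 2 (automaton_group (aleshin_type n))
      (automaton_group (bellaterra_union [fset 0; n]%fset)).
  move=> n0; apply: aleshin_actions_index2; first by rewrite !inE.
  apply/seteqP; split=> [_ [m [+ m0 [q ->]]]|_ [q _ <-]].
    rewrite !inE => /orP[/eqP m00|/eqP mn]; first by rewrite m00 in m0.
    by subst m; exists q.
  by exists n; rewrite !inE eqxx orbT; split=> //; exists q.
(* [aleshin] is [aleshin_type 1] by definition. *)
split; first exact: index2.
split=> // N _ N0; apply: aleshin_actions_index2; first by rewrite !inE orbT.
rewrite range_aleshin_union //; apply/seteqP.
split=> f [n [nN n0 fE]]; exists n; split=> //; last by rewrite inE nN.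
by move: nN n0; rewrite !inE => /orP[//|/eqP ->].
Qed.
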